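(* As $n\to\infty$, the probability densities $$\frac{1}{\sqrt n}K_n(\sqrt n\,x,\sqrt n\,x)=\frac{1}{\sqrt{2\pi n}}\sum_{k=0}^{n-1}\frac{He_k(\sqrt n\,x)^2}{k!}\,e^{-\frac12 nx^2}$$ converge weakly (as probability measures on $\mathbb{R}$) to the semi-circle law with density $\frac{1}{2\pi}\sqrt{4-x^2}$ supported on $[-2,2]$.
   Context: $He_n(x)=\mathbb{E}_{Z\sim\mathcal{N}(0,1)}[(x+\imath Z)^n]$ ($\imath=\sqrt{-1}$) is the probabilist's Hermite polynomial, $\Psi_j(x)=\frac{1}{\sqrt{j!}}He_j(x)\sqrt{\frac{1}{\sqrt{2\pi}}e^{-\frac12x^2}}$, and the Hermite kernel of order $n$ is $$K_n(x,y)=\sum_{j=0}^{n-1}\Psi_j(x)\Psi_j(y)=\frac{e^{-x^2/4-y^2/4}}{\sqrt{2\pi}}\sum_{j=0}^{n-1}\frac{1}{j!}He_j(x)He_j(y).$$ *)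

(* Defs.v *)
From HB Require Import structures.
From mathcomp Require Import all_boot all_order all_algebra.
From mathcomp Require Import all_classical all_reals all_analysis.
From mathcomp Require Import measurable_realfun complex.

Set Implicit Arguments.
Unset Strict Implicit.
Unset Printing Implicit Defensive.

Import Order.TTheory GRing.Theory Num.Theory.
Import numFieldNormedType.Exports.

Local Open Scope classical_set_scope.
Local Open Scope ring_scope.

(* The library expectation is for real random variables; this one is taken on
   the real and imaginary parts. *)
Definition cexpectation {d} {T : measurableType d} {R : realType}
    (P : probability T R) (X : T -> R[i]) : R[i] :=
  Complex (fine 'E_P[fun w => complex.Re (X w)])
          (fine 'E_P[fun w => complex.Im (X w)]).

(* E[(x + iZ)^n] with Z ~ N(0,1), as a complex number. *)
Definition HeC {R : realType} (n : nat) (x : R) : R[i] :=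
  cexpectation (normal_prob (0 : R) 1) (fun z : R => (x%:C + 'i * z%:C)%C ^+ n).

(* The number HeC n x is real: see HeC_real below. *)
Definition He {R : realType} (n : nat) (x : R) : R := complex.Re (HeC n x).

Section HeC_real.
Context {R : realType}.
Notation P := (normal_prob (0 : R) 1).

Let integralN (D : set R) (f : R -> \bar R)
    (mu : {measure set (measurableTypeR R) -> \bar R}) :
  (forall A : set R, measurable A ->
    pushforward mu (-%R : _ -> measurableTypeR R) A = mu A) ->
  measurable D -> measurable_fun [set: R] f -> (forall z, 0 <= f z)%E ->
  (\int[mu]_(z in (-%R : _ -> measurableTypeR R) @^-1` D) f (- z)%R =
   \int[mu]_(z in D) f z)%E.
Proof.
move=> muN mD mf f0.
rewrite -ge0_integral_pushforward//=; last exact: measurable_funS mf.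
by apply: eq_measure_integral => //= B mB _; exact: muN.
Qed.

Let normal_probN (A : set R) : measurable A ->
  pushforward P (-%R : _ -> measurableTypeR R) A = P A.
Proof.
move=> mA; rewrite /pushforward /normal_prob.
have pdfN (z : R) : normal_pdf 0 1 (- z) = normal_pdf 0 1 z.
  by rewrite !normal_pdfE ?oner_neq0// /normal_fun !subr0 sqrrN.
under eq_integral do rewrite -pdfN.
apply: (@integralN A (EFin \o normal_pdf (0 : R) 1) lebesgue_measure) => //.
- by move=> B mB; exact: lebesgue_measureN.
- exact: measurableT_comp (@EFin_measurable R setT) (measurable_normal_pdf 0 1).
- by move=> z; rewrite /= lee_fin normal_pdf_ge0.
Qed.

Let integral_odd (f : R -> R) : measurable_fun [set: R] f ->
  (forall z, f (- z) = - f z) -> fine 'E_P[f] = 0.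
Proof.
move=> mf fN; rewrite unlock integralE.
have fneg z : ((EFin \o f)^\- z = (EFin \o f)^\+ (- z)%R)%E.
  by rewrite funeposE funenegE /= fN.
under [X in (_ - X)%E]eq_integral do rewrite fneg.
rewrite -[X in (_ - X)%E](_ : (\int[P]_z (EFin \o f)^\+ z)%E = _).
  by case: (\int[P]_z (EFin \o f)^\+ z)%E => //= r; rewrite subrr.
rewrite -(@integralN setT _ P)// ?preimage_setT//.
by apply: measurable_funepos; exact/measurable_EFinP.
Qed.

Let measurable_pow (n : nat) (x : R) :
  measurable_fun [set: R] (fun z : R => complex.Re ((x%:C + 'i * z%:C)%C ^+ n)) /\
  measurable_fun [set: R] (fun z : R => complex.Im ((x%:C + 'i * z%:C)%C ^+ n)).
Proof.
elim: n => [|n [IHr IHi]]; first by split; exact: measurable_cst.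
have E (z : R) : (x%:C + 'i * z%:C)%C ^+ n.+1 =
  Complex (x * complex.Re ((x%:C + 'i * z%:C)%C ^+ n) -
           z * complex.Im ((x%:C + 'i * z%:C)%C ^+ n))
          (x * complex.Im ((x%:C + 'i * z%:C)%C ^+ n) +
           z * complex.Re ((x%:C + 'i * z%:C)%C ^+ n)).
  rewrite exprS; case: (_ ^+ n) => a b /=; simpc.
  by congr Complex; rewrite ?mul1r // ?addr0 ?add0r; simpc.
split; under eq_fun do rewrite E /=.
  by apply: measurable_funB; apply: measurable_funM.
by apply: measurable_funD; apply: measurable_funM.
Qed.

Lemma HeC_real (n : nat) (x : R) : HeC n x = (He n x)%:C%C.
Proof.
rewrite /He /HeC /cexpectation /real_complex_def /=; congr Complex.
apply: integral_odd => [|z]; first exact: (measurable_pow n x).2.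
have -> : (x%:C + 'i * (- z)%:C)%C = ((x%:C + 'i * z%:C)^*)%C.
  by simpc.
by rewrite -rmorphXn /=; case: (_ ^+ n).
Qed.

End HeC_real.

Definition Psi {R : realType} (j : nat) (x : R) : R :=
  (Num.sqrt j`!%:R)^-1 * He j x *
  Num.sqrt ((Num.sqrt (2 * pi))^-1 * expR (- (x ^+ 2 / 2))).

Definition hermite_kernel {R : realType} (n : nat) (x y : R) : R :=
  \sum_(j < n) Psi j x * Psi j y.

Definition semicircle_pdf {R : realType} (x : R) : R :=
  (2 * pi)^-1 * Num.sqrt (4 - x ^+ 2) * \1_(`[-2, 2] : set R) x.

Definition has_density {R : realType} (P : probability (measurableTypeR R) R)
    (p : R -> R) : Prop :=
  [/\ measurable_fun [set: R] p, forall x, 0 <= p x &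
      forall A : set R, measurable A ->
        P A = (\int[lebesgue_measure]_(x in A) (p x)%:E)%E].

(* mathcomp-analysis has no weak convergence of measures; these are the usual
   test functions, f : R -> R bounded and continuous. *)
Definition weakly_converges {R : realType}
    (P : nat -> probability (measurableTypeR R) R)
    (Q : probability (measurableTypeR R) R) : Prop :=
  forall f : R -> R, continuous f -> bounded_fun f ->
    ('E_(P n)[f] @[n --> \oo] --> 'E_Q[f])%E.

(* Main.v *)
From HB Require Import structures.
Require Import Defs.
From mathcomp Require Import all_boot all_order all_algebra.
From mathcomp Require Import all_classical all_reals all_analysis.
From mathcomp Require Import measurable_realfun complex ring lra.
Import Order.TTheory GRing.Theory Num.Theory.
Import numFieldNormedType.Exports.
Local Open Scope classical_set_scope.
Local Open Scope ring_scope.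
Set Implicit Arguments.
Unset Strict Implicit.
Unset Printing Implicit Defensive.

(** The proof is the method of moments, with the moments computed by a recursion
    in the style of Haagerup-Thorbjornsen instead of by counting lattice paths.

    Write phi for the standard Gaussian density and S_n = sum_(j < n) He_j^2 / j!,
    so that K_n(y, y) = S_n(y) phi(y).  For a polynomial p one has
    (p phi)' = (D p) phi with D p = p' - X p ([gderiv]).  The three-term recurrence
    and the confluent Christoffel-Darboux formula express both S_n and D S_n as
    quadratic forms in He_n and He_(n-1), and this gives the third-order equation
      D^3 S_n + (4 n - X^2) D S_n + X S_n = 0          ([kernel_ode]).
    Integrating it against X^(k+1) phi by parts yields, for the moments m_k of
    the rescaled density,
      (k+4) m_(k+2) = 4 (k+1) m_k + (k+1) k (k-1) n^-2 m_(k-2),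
    with m_0 = 1 and m_1 = 0.  The semicircle density s satisfies the first-order
    equation (4 - x^2) s' + x s = 0, whose moments obey the same recursion without
    the n^-2 term; hence all moments converge ([cvg_hermite_moment]).

    Moments determine the limit because the semicircle law has bounded support:
    a bounded continuous function is uniformly close on [-4, 4] to a polynomial
    ([weierstrass_approximation]), and outside this interval the error is at most
    K (x/4)^(2k) for every large k, whose integral is about K (2/4)^(2k) at most
    since the 2k-th limit moment is at most 2^(2k) ([weakly_converges_moments]).

    All Gaussian integrals of polynomials are handled through the two facts that
    characterize them, L 1 = 1 and L (X p) = L p' ([gaussian_moments]).  The same
    integration by parts identifies E[(x + iZ)^n] with the polynomial given by the
    three-term recurrence ([He_hermite]).  The rescaling by sqrt n is absorbed in
    the variance: K_n(sqrt n x, sqrt n x) / sqrt n is S_n(sqrt n x) / n times the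
    density of N(0, 1/n) ([hermite_densityE]). *)

(** * Weierstrass approximation by Bernstein polynomials *)

Section weierstrass_approximation.
Context {R : realType}.
Implicit Types (g h : nat -> R) (t : R).

(** The Bernstein polynomial of the values [g 0, ..., g m], that is the
    expectation of [g] at a binomial variable, built by conditioning on one trial;
    in this form its properties are immediate inductions, without binomial
    coefficients. *)
Fixpoint bernstein (m : nat) (g : nat -> R) : {poly R} :=
  if m is m'.+1 then
    'X * bernstein m' (g \o succn) + (1 - 'X) * bernstein m' g
  else (g 0)%:P.

Lemma bernsteinS m g t : (bernstein m.+1 g).[t] =
  t * (bernstein m (g \o succn)).[t] + (1 - t) * (bernstein m g).[t].
Proof. by rewrite /= !hornerE. Qed.

Lemma bernstein_cst m (c : R) t : (bernstein m (fun=> c)).[t] = c.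
Proof.
elim: m => [|m IH]; first by rewrite hornerC.
by rewrite bernsteinS IH; ring.
Qed.

Lemma bernsteinB m g h t : (bernstein m (fun j => g j - h j)).[t] =
  (bernstein m g).[t] - (bernstein m h).[t].
Proof.
elim: m g h => [|m IH] g h; first by rewrite !hornerE.
rewrite !bernsteinS IH.
have -> : (fun j => g j - h j) \o succn =
          (fun j => (g \o succn) j - (h \o succn) j) by [].
by rewrite IH; ring.
Qed.

Lemma ler_bernstein m g h t : 0 <= t <= 1 ->
  (forall j, (j <= m)%N -> g j <= h j) ->
  (bernstein m g).[t] <= (bernstein m h).[t].
Proof.
move=> /andP[t0 t1]; elim: m g h => [|m IH] g h gh.
  by rewrite !hornerC gh.
rewrite !bernsteinS; apply: lerD; apply: ler_wpM2l => //; rewrite ?subr_ge0 //.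
  by apply: IH => j jm /=; exact: gh.
by apply: IH => j jm; apply: gh; exact: leqW.
Qed.

(** The bias-variance decomposition for a binomial variable; the affine form is
    the one in which it bounds the approximation error. *)
Lemma bernstein_sqr m (a b s : R) t :
  (bernstein m (fun j => a + b * (j%:R - s) ^+ 2)).[t] =
  a + b * ((m%:R * t - s) ^+ 2 + m%:R * t * (1 - t)).
Proof.
elim: m s => [|m IH] s; first by rewrite hornerC; ring.
rewrite bernsteinS IH.
have -> : (fun j => a + b * (j%:R - s) ^+ 2) \o succn =
          (fun j : nat => a + b * (j%:R - (s - 1)) ^+ 2).
  by apply/funext => j /=; rewrite -natr1; ring.
by rewrite IH -natr1; ring.
Qed.

Lemma continuous_modulus (f : R -> R) (e : R) : continuous f -> 0 < e ->
  exists2 d, 0 < d &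
    forall x y, x \in `[0, 1] -> `|x - y| < d -> `|f x - f y| < e.
Proof.
move=> cf e0.
have /compact_near_coveringP := @segment_compact R 0 1.
move=> /(_ R (0 : R)^'+ (fun d x => forall y, `|x - y| < d -> `|f x - f y| < e)).
case.
  move=> x _ /=.
  have e20 : 0 < e / 2 by rewrite divr_gt0.
  have /cvgrPdist_lt /(_ _ e20) /nbhs_ballP[r /= r0 xr] := cf x.
  exists (ball x (r / 2), `]0, r / 2[%classic) => /=.
    split; first by apply: nbhsx_ballx; rewrite divr_gt0.
    near=> d; rewrite /= in_itv/=; apply/andP; split => //.
    by near: d; apply: nbhs_right_lt; rewrite divr_gt0.
  move=> [z d] /= [xz]; rewrite in_itv /= => /andP[d0 dr] y zy.
  have fz : `|f x - f z| < e / 2.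
    by apply: xr; rewrite /ball/=; apply: lt_le_trans xz _; lra.
  have fy : `|f x - f y| < e / 2.
    apply: xr; rewrite /ball/=; rewrite -(subrKA z).
    by apply: le_lt_trans (ler_normD _ _) _; move: xz; rewrite /ball/=; lra.
  move: fy fz; rewrite !ltr_norml => /andP[? ?] /andP[? ?].
  by apply/andP; split; lra.
move=> d /= d0 dP; exists (d / 2); first by rewrite divr_gt0.
move=> x y x01 xy; apply: dP x01 _ xy => /=; last by rewrite divr_gt0.
by rewrite sub0r normrN ger0_norm; lra.
Unshelve. all: by end_near.
Qed.

(** Where [|t - j/m| < d] the values of [f] differ by at most e/2, elsewhere by
    at most 2 M (t - j/m)^2 / d^2; averaging over [j] turns the square into a
    variance of order 1/m. *)
Lemma weierstrass01 (f : R -> R) (e : R) : continuous f -> 0 < e ->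
  exists p : {poly R}, forall t, 0 <= t <= 1 -> `|f t - p.[t]| <= e.
Proof.
move=> cf e0; have e20 : 0 < e / 2 by rewrite divr_gt0.
have [d d0 fd] := continuous_modulus cf e20.
have [M M0 fM] : exists2 M, 0 < M & forall t, 0 <= t <= 1 -> `|f t| <= M.
  have cf' : {within `[0, 1], continuous f} by exact: continuous_subspaceT.
  have [M [_ fM]] :=
    compact_bounded (continuous_compact cf' (@segment_compact R 0 1)).
  exists (`|M| + 1) => [|t t01]; first by rewrite ltr_wpDl.
  apply: (fM (`|M| + 1)); last by exists t => //=; rewrite in_itv.
  by rewrite (le_lt_trans (ler_norm M))// ltrDl.
(* Makes 2 M t (1 - t) / (d^2 m) smaller than e/2. *)
pose m := (Num.truncn (4 * M / (d ^+ 2 * e))).+1.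
exists (bernstein m (fun j => f (j%:R / m%:R))) => t t01.
have m0 : 0 < m%:R :> R by rewrite ltr0n.
have b j : (j <= m)%N -> `|f t - f (j%:R / m%:R)| <=
    e / 2 + 2 * M / d ^+ 2 / m%:R ^+ 2 * (j%:R - m%:R * t) ^+ 2.
  move=> jm.
  have K0 : 0 <= 2 * M / d ^+ 2 / m%:R ^+ 2 by rewrite !divr_ge0 ?sqr_ge0//; lra.
  have [lt_d|ge_d] := ltP `|t - j%:R / m%:R| d.
    have /ltW := fd t (j%:R / m%:R) t01 lt_d.
    by move=> /le_trans; apply; rewrite lerDl mulr_ge0 ?sqr_ge0.
  have -> : 2 * M / d ^+ 2 / m%:R ^+ 2 * (j%:R - m%:R * t) ^+ 2 =
            2 * M * ((t - j%:R / m%:R) ^+ 2 / d ^+ 2).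
    by field; rewrite !gt_eqF.
  have : 1 <= (t - j%:R / m%:R) ^+ 2 / d ^+ 2.
    rewrite ler_pdivlMr ?exprn_gt0// mul1r -[leRHS]ger0_norm ?sqr_ge0// normrX.
    by rewrite lerXn2r ?nnegrE// ltW.
  move=> h; have : 2 * M * 1 <= 2 * M * ((t - j%:R / m%:R) ^+ 2 / d ^+ 2).
    by apply: ler_wpM2l h; lra.
  have : `|f t - f (j%:R / m%:R)| <= M + M.
    apply: le_trans (ler_normB _ _) _; apply: lerD; apply: fM => //.
    by rewrite divr_ge0//= ler_pdivrMr// mul1r ler_nat.
  lra.
have bnd : (bernstein m (fun j => e / 2 + 2 * M / d ^+ 2 / m%:R ^+ 2 *
    (j%:R - m%:R * t) ^+ 2)).[t] <= e.
  rewrite bernstein_sqr subrr expr0n/= add0r.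
  have -> : 2 * M / d ^+ 2 / m%:R ^+ 2 * (m%:R * t * (1 - t)) =
            (2 * M / d ^+ 2) * (t * (1 - t)) / m%:R by field; rewrite !gt_eqF.
  suff : 2 * M / d ^+ 2 * (t * (1 - t)) / m%:R <= e / 2 by lra.
  rewrite ler_pdivrMr//.
  have : 2 * M / d ^+ 2 * (t * (1 - t)) <= 2 * M / d ^+ 2 * 1.
    apply: ler_wpM2l; first by rewrite divr_ge0 ?sqr_ge0//; lra.
    by nra.
  move=> /le_trans; apply; rewrite mulr1.
  have : 4 * M / (d ^+ 2 * e) < m%:R by rewrite /m; exact: truncnS_gt.
  rewrite ltr_pdivrMr ?mulr_gt0 ?exprn_gt0// => h.
  rewrite ler_pdivrMr ?exprn_gt0//; nra.
rewrite -[f t](bernstein_cst m _ t) -bernsteinB ler_norml; apply/andP; split.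
  rewrite lerNl; apply: le_trans bnd.
  have := @bernsteinB m (fun=> 0) (fun j => f t - f (j%:R / m%:R)) t.
  rewrite bernstein_cst sub0r => <-; apply: ler_bernstein => // j /b.
  by rewrite ler_norml sub0r => /andP[]; lra.
apply: le_trans bnd; apply: ler_bernstein => // j /b.
by rewrite ler_norml => /andP[].
Qed.

Lemma weierstrass_approximation (f : R -> R) (a b e : R) : a < b ->
  continuous f -> 0 < e ->
  exists p : {poly R}, forall x, a <= x <= b -> `|f x - p.[x]| <= e.
Proof.
move=> ab cf e0.
have cg : continuous (fun t => f (a + (b - a) * t)).
  move=> t; apply: (@continuous_comp _ _ _ (fun t => a + (b - a) * t) f).
    2: exact: cf.
  by apply: cvgD; [exact: cvg_cst|apply: cvgM; [exact: cvg_cst|exact: cvg_id]].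
have [p pP] := weierstrass01 cg e0.
have ba : b - a != 0 by rewrite gt_eqF// subr_gt0.
exists (p \Po ((b - a)^-1 *: ('X - a%:P))) => x /andP[ax xb].
rewrite horner_comp !hornerE.
have := pP ((b - a)^-1 * (x - a)).
have -> : a + (b - a) * ((b - a)^-1 * (x - a)) = x by field.
apply; rewrite mulr_ge0 ?invr_ge0 ?subr_ge0 ?(ltW ab)//=.
by rewrite ler_pdivrMl ?subr_gt0// mulr1; lra.
Qed.

End weierstrass_approximation.

(** * Weak convergence by the method of moments *)

Section moment_method.
Context {R : realType}.
Notation prob := (probability (measurableTypeR R) R).

Definition has_moments (P : prob) :=
  forall k, P.-integrable [set: R] (fun x : R => (x ^+ k)%:E).

Lemma integrable_horner (P : prob) (p : {poly R}) : has_moments P ->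
  P.-integrable [set: R] (fun x : R => p.[x]%:E).
Proof.
move=> mP; rewrite -[p]coefK poly_def.
elim/big_rec : _ => [|i q _ qP].
  by under eq_fun do rewrite horner0; exact: integrable0.
under eq_fun do rewrite hornerD hornerZ hornerXn EFinD EFinM.
by apply: integrableD => //; apply: integrableZl => //; exact: mP.
Qed.

Lemma cvg_integral_horner (mu_ : nat -> prob) (Q : prob) (p : {poly R}) :
  (forall n, has_moments (mu_ n)) -> has_moments Q ->
  (forall k, \int[mu_ n]_x (x ^+ k) @[n --> \oo] --> \int[Q]_x (x ^+ k)) ->
  \int[mu_ n]_x p.[x] @[n --> \oo] --> \int[Q]_x p.[x].
Proof.
move=> mmu mQ mom; rewrite -[p]coefK poly_def.
elim/big_rec : _ => [|i q _ IH].
  have E (P : prob) : \int[P]_x (0 : {poly R}).[x] = 0.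
    by under eq_Rintegral do rewrite horner0; rewrite /Rintegral integral0.
  by rewrite E; under eq_fun do rewrite E; exact: cvg_cst.
have E (P : prob) : has_moments P ->
    \int[P]_x (p`_i *: 'X^i + q).[x] =
    p`_i * \int[P]_x (x ^+ i) + \int[P]_x q.[x].
  move=> mP; under eq_Rintegral do rewrite hornerD hornerZ hornerXn.
  rewrite RintegralD//; last exact: integrable_horner.
    by rewrite RintegralZl//; exact: mP.
  under [X in integrable _ _ X]eq_fun do rewrite /= EFinM.
  by apply: integrableZl => //; exact: mP.
rewrite E//; under eq_fun do rewrite E//.
by apply: cvgD => //; apply: cvgM => //; exact: cvg_cst.
Qed.

(** Once [|x / a| >= 1], each of the terms of [f - p] is dominated by a constant
    times (x/a)^(2k); the same constant serves all [k], so that [k] can be chosen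
    after it. *)
Lemma bounded_sub_horner_tail (f : R -> R) (p : {poly R}) (C a : R) : 0 < a ->
  (forall x, `|f x| <= C) ->
  exists2 K, 0 <= K & forall k, (size p <= k)%N -> forall x, a <= `|x| ->
    `|f x - p.[x]| <= K * (x / a) ^+ (2 * k).
Proof.
move=> a0 fC; exists (C + \sum_(i < size p) `|p`_i| * a ^+ i).
  rewrite addr_ge0 ?(le_trans (normr_ge0 _) (fC 0))// sumr_ge0// => i _.
  by rewrite mulr_ge0// exprn_ge0// ltW.
move=> k pk x ax; set y := x / a.
have y1 : 1 <= `|y|.
  by rewrite /y normrM normfV (gtr0_norm a0) ler_pdivlMr// mul1r.
have -> : y ^+ (2 * k) = `|y| ^+ (2 * k).
  by rewrite !exprM -normrX ger0_norm ?sqr_ge0.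
rewrite mulrDl; apply: le_trans (ler_normB _ _) _; apply: lerD.
  apply: le_trans (fC x) _; rewrite ler_peMr ?exprn_ege1//.
  exact: le_trans (normr_ge0 _) (fC 0).
rewrite horner_coef mulr_suml; apply: le_trans (ler_norm_sum _ _ _) _.
apply: ler_sum => i _.
have -> : x = a * y by rewrite /y mulrC divfK ?gt_eqF.
rewrite normrM normrX normrM (gtr0_norm a0) exprMn mulrA.
apply: ler_wpM2l; first by rewrite mulr_ge0// exprn_ge0// ltW.
apply: ler_weXn2l => //; rewrite (leq_trans (ltnW (ltn_ord i)))//.
by rewrite (leq_trans pk)// leq_pmull.
Qed.

Lemma dist_integral_moment (P : prob) (f : R -> R) (p : {poly R})
    (e K : R) (k : nat) :
  has_moments P -> P.-integrable [set: R] (EFin \o f) ->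
  (forall x, `|f x - p.[x]| <= e + K * x ^+ k) ->
  `|\int[P]_x f x - \int[P]_x p.[x]| <= e + K * \int[P]_x (x ^+ k).
Proof.
move=> mP fP fp; have pP := integrable_horner p mP.
have fpP : P.-integrable [set: R] (EFin \o (fun x => f x - p.[x])).
  by under [X in integrable _ _ X]eq_fun do rewrite /= EFinB; exact: integrableB.
rewrite -RintegralB//; apply: le_trans (le_normr_Rintegral _ fpP) _ => //.
have xP : P.-integrable [set: R] (EFin \o (fun x => K * x ^+ k)).
  under [X in integrable _ _ X]eq_fun do rewrite /= EFinM.
  by apply: integrableZl => //; exact: mP.
have cP : P.-integrable [set: R] (EFin \o cst e).
  by apply: finite_measure_integrable_cst.
have -> : e + K * \int[P]_x (x ^+ k) = \int[P]_x (e + K * x ^+ k).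
  rewrite RintegralD// RintegralZl//; last exact: mP.
  by rewrite Rintegral_cst//= probability_setT mulr1.
apply: le_Rintegral => //.
- exact: integrable_norm fpP.
- under [X in integrable _ _ X]eq_fun do rewrite /= EFinD.
  exact: integrableD.
Qed.

(** The bound on the even moments of [Q] stands for a support contained in
    [[-r, r]].  The polynomial approximation is taken on [[-2r, 2r]]: the factor 2
    makes the tail term K (x/2r)^(2k) integrate to at most K 4^-k under [Q], and,
    as its moment of order 2k converges, to at most twice that under [mu_ n]. *)
Theorem weakly_converges_moments (mu_ : nat -> prob) (Q : prob) (r : R) : 0 < r ->
  (forall n, has_moments (mu_ n)) -> has_moments Q ->
  (forall k, \int[mu_ n]_x (x ^+ k) @[n --> \oo] --> \int[Q]_x (x ^+ k)) ->
  (forall k, \int[Q]_x (x ^+ (2 * k)) <= r ^+ (2 * k)) ->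
  weakly_converges mu_ Q.
Proof.
move=> r0 mmu mQ mom Qr f cf bf.
have [C fC] : exists C : R, forall x, `|f x| <= C.
  have [M [_ fM]] := bf; exists (`|M| + 1) => x.
  by apply: fM => //; rewrite (le_lt_trans (ler_norm M))// ltrDl.
have mf : measurable_fun [set: R] f by exact: continuous_measurable_fun.
have fi (P : prob) : P.-integrable [set: R] (EFin \o f).
  apply: (@le_integrable _ _ _ P _ measurableT _ (EFin \o cst C)).
  - exact/measurable_EFinP.
  - by move=> x _; rewrite /= lee_fin (le_trans (fC x))// ler_norm.
  - exact: finite_measure_integrable_cst.
have EE (P : prob) : ('E_P[f] = (\int[P]_x f x)%:E)%E.
  by rewrite unlock fineK//; apply: integrable_fin_num => //; exact: fi.
rewrite EE; under eq_fun do rewrite EE.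
apply: cvg_EFin; first by exact: nearW.
apply/cvgrPdist_le => e e0 /=.
have e6 : 0 < e / 6 by rewrite divr_gt0.
have a0 : 0 < 2 * r by rewrite mulr_gt0.
have rr : - (2 * r) < 2 * r by lra.
(* The error splits into six parts: two for f - p under Q, three under mu_ n,
   and one for the integrals of p. *)
have [p fp] := weierstrass_approximation rr cf e6.
have [K K0 fpK] := bounded_sub_horner_tail p a0 fC.
have [k pk Kk] : exists2 k, (size p <= k)%N & K * 4^-1 ^+ k <= e / 6.
  have : K * 4^-1 ^+ k @[k --> \oo] --> K * 0.
    apply: cvgM; first exact: cvg_cst.
    by apply: cvg_expr; rewrite gtr0_norm// invf_lt1//; lra.
  rewrite mulr0 => /cvgr_le /(_ _ e6) [N _ NP].
  exists (maxn N (size p)); first exact: leq_maxr.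
  by apply: NP; exact: leq_maxl.
set K' := K / (2 * r) ^+ (2 * k).
have bnd x : `|f x - p.[x]| <= e / 6 + K' * x ^+ (2 * k).
  have y0 : 0 <= K' * x ^+ (2 * k).
    apply: mulr_ge0; first by rewrite divr_ge0 ?exprn_ge0// ltW.
    by rewrite exprM exprn_ge0 ?sqr_ge0.
  have [/ltW x2r|x2r] := ltP `|x| (2 * r).
    by apply: (le_trans (fp x _)); [rewrite -ler_norml|rewrite lerDl].
  apply: le_trans (fpK k pk x x2r) _.
  have -> : K * (x / (2 * r)) ^+ (2 * k) = K' * x ^+ (2 * k).
    by rewrite /K' expr_div_n mulrAC mulrA.
  by rewrite lerDr ltW.
have K'r : K' * r ^+ (2 * k) <= e / 6.
  apply: le_trans Kk; rewrite /K' exprMn exprM.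
  rewrite -mulrA; apply: ler_wpM2l => //.
  rewrite invfM mulrVK ?unitfE ?gt_eqF ?exprn_gt0//.
  by rewrite exprVn (_ : 4 = 2 ^+ 2 :> R)//; ring.
have K'0 : 0 <= K' by rewrite /K' divr_ge0 ?exprn_ge0// ltW.
have rk0 : 0 < r ^+ (2 * k) by rewrite exprn_gt0.
near=> n.
have h1 := dist_integral_moment (mmu n) (fi _) bnd.
have h2 := dist_integral_moment mQ (fi _) bnd.
have h3 : `|\int[Q]_x p.[x] - \int[mu_ n]_x p.[x]| <= e / 6.
  near: n; move/cvgrPdist_le : (@cvg_integral_horner mu_ Q p mmu mQ mom); exact.
have h4 : `|\int[Q]_x (x ^+ (2 * k)) - \int[mu_ n]_x (x ^+ (2 * k))|
    <= r ^+ (2 * k).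
  by near: n; move/cvgrPdist_le : (mom (2 * k)%N); exact.
have h5 := Qr k.
have h6 : K' * \int[Q]_x (x ^+ (2 * k)) <= e / 6.
  by apply: le_trans K'r; exact: ler_wpM2l.
have h7 : K' * \int[mu_ n]_x (x ^+ (2 * k)) <= e / 6 + e / 6.
  apply: le_trans (lerD K'r K'r); rewrite -mulrDr; apply: ler_wpM2l => //.
  by move: h4 h5; rewrite ler_norml; clear; move=> /andP[]; lra.
move: h1 h2 h3 h6 h7; rewrite !ler_norml.
move: (\int[mu_ n]_x f x) (\int[Q]_x f x) (\int[mu_ n]_x p.[x])
  (\int[Q]_x p.[x]) (K' * \int[mu_ n]_x _) (K' * \int[Q]_x _)
  => fn fQ pn pQ mn mQ'.
clear - e; move=> /andP[? ?] /andP[? ?] /andP[? ?] ? ?.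
by apply/andP; split; lra.
Unshelve. all: by end_near.
Qed.

End moment_method.

(** * Probability measures with a density *)

Section density.
Context {R : realType}.
Notation lebesgue := (@lebesgue_measure R).
Variables (P : probability (measurableTypeR R) R) (p : R -> R).
Hypothesis Pp : has_density P p.

Let mp : measurable_fun [set: R] p. Proof. by case: Pp. Qed.
Let p0 x : 0 <= p x. Proof. by case: Pp. Qed.
Let PE (A : set R) : measurable A -> (P A = \int[lebesgue]_(x in A) (p x)%:E)%E.
Proof. by case: Pp => _ _; exact. Qed.

Lemma density_dominates : P `<< lebesgue.
Proof.
apply/null_content_dominatesP => A mA A0; rewrite PE//.
apply: null_set_integral => //; exact/measurable_funTS/measurable_EFinP.
Qed.

(** The density is almost everywhere the Radon-Nikodym derivative, for which the
    change of variables is known. *)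
Lemma ge0_integral_density (f : R -> \bar R) : (forall x, 0 <= f x)%E ->
  measurable_fun [set: R] f ->
  (\int[P]_x f x = \int[lebesgue]_x (f x * (p x)%:E))%E.
Proof.
move=> f0 mf; have dP := density_dominates.
rewrite -(Radon_Nikodym_SigmaFinite.change_of_variables dP)//.
have mRN := measurable_int _ (Radon_Nikodym_SigmaFinite.f_integrable dP).
apply: ae_eq_integral => //.
- exact: emeasurable_funM.
- by apply: emeasurable_funM => //; exact/measurable_EFinP.
- apply: ae_eqe_mul2l; apply: integral_ae_eq => //.
  + exact: Radon_Nikodym_SigmaFinite.f_integrable.
  + exact/measurable_EFinP.
  + move=> A _ mA; transitivity (P A); last exact: PE.
    exact/esym/Radon_Nikodym_SigmaFinite.f_integral.
Qed.

Lemma integrable_densityP (f : R -> R) : measurable_fun [set: R] f ->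
  lebesgue.-integrable [set: R] (fun x => (f x * p x)%:E) ->
  P.-integrable [set: R] (fun x => (f x)%:E).
Proof.
move=> mf /integrableP[_ fp]; apply/integrableP; split.
  exact/measurable_EFinP.
rewrite ge0_integral_density//; last first.
  by apply/measurable_EFinP; exact: measurableT_comp.
apply: le_lt_trans fp; rewrite le_eqVlt; apply/orP; left; apply/eqP.
by apply: eq_integral => x _; rewrite /= -EFinM normrM (ger0_norm (p0 x)).
Qed.

Lemma Rintegral_density (f : R -> R) : measurable_fun [set: R] f ->
  \int[P]_x f x = \int[lebesgue]_x (f x * p x).
Proof.
move=> mf; rewrite /Rintegral; congr fine.
rewrite integralE [RHS]integralE.
have mf' : measurable_fun [set: R] (fun x => (f x)%:E) by exact/measurable_EFinP.
rewrite !ge0_integral_density//; last 2 first.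
- exact: measurable_funeneg.
- exact: measurable_funepos.
congr (_ - _)%E; apply: eq_integral => x _.
  by rewrite !funeposE /= EFinM maxe_pMl ?mul0e// lee_fin.
rewrite !funenegE /= -mulNr EFinM maxe_pMl ?mul0e ?lee_fin//.
Qed.

End density.

Section density_prob.
Context {R : realType}.
Notation lebesgue := (@lebesgue_measure R).

Lemma exists_density_prob (p : R -> R) : measurable_fun [set: R] p ->
  (forall x, 0 <= p x) -> (\int[lebesgue]_x (p x)%:E = 1)%E ->
  exists P : probability (measurableTypeR R) R, has_density P p.
Proof.
move=> mp p0 p1.
pose nu (A : set (measurableTypeR R)) := (\int[lebesgue]_(x in A) (p x)%:E)%E.
have nu0 : nu set0 = 0%E by rewrite /nu integral_set0.
have nu_ge0 A : (0 <= nu A)%E.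
  by apply: integral_ge0 => x _; rewrite lee_fin.
have nu_sigma : semi_sigma_additive nu.
  move=> A mA tA mUA; rewrite /nu ge0_integral_bigcup//.
  - apply: is_cvg_ereal_nneg_natsum_cond => n _ _; exact: nu_ge0.
  - exact/measurable_funTS/measurable_EFinP.
  - by move=> x _; rewrite lee_fin.
pose nuM := isMeasure.Build _ _ _ nu nu0 nu_ge0 nu_sigma.
pose nu' : {measure set (measurableTypeR R) -> \bar R} := HB.pack nu nuM.
pose nuP := @Measure_isProbability.Build _ _ R nu' p1.
pose P : probability (measurableTypeR R) R := HB.pack (Measure.sort nu') nuP.
by exists P; split.
Qed.

End density_prob.

(** * Gaussian integration by parts *)

Section real_line_ftc.
Context {R : realType}.
Notation lebesgue := (@lebesgue_measure R).

(** The bound on [x * F x] is a convenient way to say that [F] vanishes at both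
    ends of the line. *)
Lemma Rintegral_derive_eq0 (F f : R -> R) (B : R) :
  (forall x : R, is_derive x 1 F (f x)) -> continuous f ->
  lebesgue.-integrable [set: R] (EFin \o f) ->
  (forall x, `|x * F x| <= B) ->
  \int[lebesgue]_x f x = 0.
Proof.
move=> dF cf fi FB.
have B0 : 0 <= B := le_trans (normr_ge0 _) (FB 0).
have mf : measurable_fun [set: R] f by exact: continuous_measurable_fun.
have mEf : measurable_fun [set: R] (EFin \o f) by exact/measurable_EFinP.
pose I (n : nat) : set R := `[- n.+1%:R, n.+1%:R]%classic.
have ftc n : (\int[lebesgue]_(x in I n) (f x)%:E =
    (F n.+1%:R)%:E - (F (- n.+1%:R))%:E)%E.
  apply: continuous_FTC2.
  - by rewrite gtrN.
  - exact: continuous_subspaceT.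
  - have dF' x : derivable F x 1 by case: (dF x).
    have cF x : {for x, continuous F}.
      by apply: differentiable_continuous; exact/derivable1_diffP.
    by split => //; [exact/cvg_at_right_filter/cF|exact/cvg_at_left_filter/cF].
  - by move=> x _; rewrite derive1E; have [_ ->] := dF x.
have Fn0 : F n.+1%:R - F (- n.+1%:R) @[n --> \oo] --> (0 : R).
  apply/cvgr0Pnorm_le => e e0.
  have : (B + B) * harmonic n @[n --> \oo] --> (B + B) * 0.
    by apply: cvgM; [exact: cvg_cst|exact: cvg_harmonic].
  rewrite mulr0 => /cvgr_le /(_ _ e0); apply: filterS => n.
  apply: le_trans; rewrite /harmonic /= ler_pdivlMr// mulrC.
  rewrite -[X in X * _](@ger0_norm _ n.+1%:R)// -normrM mulrBr.
  rewrite (le_trans (ler_normB _ _))// lerD//.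
  by have := FB (- n.+1%:R); rewrite mulNr normrN.
have cv : (\int[lebesgue]_(x in I n) (f x)%:E @[n --> \oo] -->
    \int[lebesgue]_x (f x)%:E)%E.
  pose g (n : nat) := (EFin \o f) \_ (I n).
  under eq_cvg do rewrite integral_mkcond.
  apply: (@dominated_cvg _ _ _ lebesgue setT measurableT g _
    (fun x => `|(f x)%:E|%E)) => //.
  - move=> n; apply/(measurable_restrictT (EFin \o f) (measurable_itv _)).
    exact: measurable_funTS mEf.
  - move=> x _; apply: cvg_near_cst.
    exists (Num.truncn `|x|).+1 => // n /= xn.
    rewrite /g patchE mem_set// /I /= in_itv/= -ler_norml ltW//.
    by rewrite (lt_le_trans (truncnS_gt _))// ler_nat ltnW.
  - exact: integrable_abse.
  - by move=> n x _ /=; rewrite /g patchE; case: ifP => //; rewrite abse0.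
rewrite /Rintegral -(cvg_lim (@ereal_hausdorff R) cv).
under eq_fun do rewrite ftc -EFinB.
by rewrite (cvg_lim (@ereal_hausdorff R) (cvg_EFin _ Fn0))//; exact: nearW.
Qed.

End real_line_ftc.

Section gaussian_moments.
Context {R : realType}.

(** These properties determine [L] as the expectation of polynomials under
    N(0, 1); the last one is Gaussian integration by parts.  The orthogonality
    relations and the moments of the kernel follow from them formally. *)
Definition gaussian_moments (L : {poly R} -> R) : Prop :=
  [/\ forall p q, L (p + q) = L p + L q,
      forall a p, L (a *: p) = a * L p,
      L 1 = 1 &
      forall p, L ('X * p) = L p^`()].

End gaussian_moments.

Section gaussian_functional.
Context {R : realType}.
Notation lebesgue := (@lebesgue_measure R).
Implicit Types (q : {poly R}) (c : R).

(** The expectation of q(cZ) where Z has standard deviation 1/c, that is of q at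
    a standard Gaussian variable.  The redundant parameter [c] lets the rescaled
    Hermite densities be integrated without changing variables. *)
Definition gauss_fctl c q : R :=
  \int[lebesgue]_x (q.[c * x] * normal_pdf 0 c^-1 x).

Lemma normal_pdf_scaled c x : c != 0 ->
  normal_pdf 0 c^-1 x = normal_peak c^-1 * expR (- ((c * x) ^+ 2 / 2)).
Proof.
move=> c0; rewrite normal_pdfE ?invr_eq0// /normal_fun subr0.
congr (_ * expR _); rewrite mulNr; congr (- _).
by rewrite -mulr_natr; field.
Qed.

(** Half of the Gaussian exponent is enough to absorb any polynomial, which
    leaves a Gaussian of twice the variance as dominating function. *)
Lemma horner_le_expR q : exists2 K, 0 <= K &
  forall y, `|q.[y]| <= K * expR (y ^+ 2 / 4).
Proof.
exists (\sum_(i < size q) `|q`_i| * (4 * i.+1%:R) ^+ i).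
  by apply: sumr_ge0 => i _; rewrite mulr_ge0 ?exprn_ge0// mulr_ge0.
move=> y; rewrite horner_coef mulr_suml; apply: le_trans (ler_norm_sum _ _ _) _.
apply: ler_sum => i _; rewrite normrM -mulrA ler_wpM2l// normrX.
(* Here |y| <= M exp (y^2 / M), and i / M <= 1/4 for the i-th power of this. *)
set M := 4 * i.+1%:R.
have M4 : 4 <= M by rewrite /M ler_peMr// ler1n.
have M0 : 0 < M by lra.
have yM : `|y| <= M * expR (y ^+ 2 / M).
  apply: (@le_trans _ _ (M * (1 + y ^+ 2 / M))); last first.
    by rewrite ler_pM2l// expR_ge1Dx.
  rewrite mulrDr mulr1 mulrCA divff ?gt_eqF// mulr1.
  by rewrite ler_norml; apply/andP; split; nra.
apply: (@le_trans _ _ ((M * expR (y ^+ 2 / M)) ^+ i)).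
  by rewrite lerXn2r// nnegrE mulr_ge0 ?expR_ge0// ltW.
rewrite [(M * _) ^+ i]exprMn; apply: ler_wpM2l; first by rewrite exprn_ge0// ltW.
rewrite -expRM_natl ler_expR.
have iM : 4 * i%:R <= M by rewrite ler_pM2l// ler_nat.
rewrite mulrCA; apply: ler_wpM2l; first exact: sqr_ge0.
by rewrite ler_pdivrMr//; lra.
Qed.

Lemma integrable_gauss_fctl c q : c != 0 ->
  lebesgue.-integrable [set: R] (fun x => (q.[c * x] * normal_pdf 0 c^-1 x)%:E).
Proof.
move=> c0; have [K K0 qK] := horner_le_expR q.
(* The dominating function has variance 2 / c^2. *)
set s := Num.sqrt 2 / c.
have s0 : s != 0 by rewrite mulf_neq0 ?invr_eq0// gt_eqF// sqrtr_gt0.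
set k := K * normal_peak c^-1 / normal_peak s.
have ki : lebesgue.-integrable [set: R]
    (fun x => (k%:E * (normal_pdf 0 s x)%:E)%E).
  by apply: integrableZl => //; exact: integrable_normal_pdf.
apply: le_integrable ki => //.
  apply/measurable_EFinP/measurable_funM; last exact: measurable_normal_pdf.
  apply: continuous_measurable_fun => x.
  apply: (@continuous_comp _ _ _ ( *%R c) (horner q)).
    by apply: cvgM; [exact: cvg_cst|exact: cvg_id].
  exact: continuous_horner.
move=> x _; rewrite -EFinM !abse_EFin lee_fin.
apply: (@le_trans _ _ (k * normal_pdf 0 s x)); last exact: ler_norm.
rewrite normrM (ger0_norm (normal_pdf_ge0 _ _ _)).
have pk0 : normal_peak s != 0 by rewrite gt_eqF// normal_peak_gt0.
have -> : k * normal_pdf 0 s x = K * normal_peak c^-1 * normal_fun 0 s x.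
  by rewrite normal_pdfE// /k; field.
rewrite normal_pdf_scaled//; apply: (le_trans (ler_wpM2r _ (qK _))).
  by rewrite mulr_ge0 ?normal_peak_ge0 ?expR_ge0.
rewrite -!mulrA; apply: ler_wpM2l => //; rewrite mulrCA.
apply: ler_wpM2l; first exact: normal_peak_ge0.
rewrite -expRD ler_expR subr0.
suff -> : - x ^+ 2 / (s ^+ 2 *+ 2) = - (c * x) ^+ 2 / 4 by lra.
by rewrite -mulr_natr /s expr_div_n sqr_sqrtr//; field.
Qed.

Lemma gauss_fctlD c p q : c != 0 ->
  gauss_fctl c (p + q) = gauss_fctl c p + gauss_fctl c q.
Proof.
move=> c0; rewrite /gauss_fctl -RintegralD//; try exact: integrable_gauss_fctl.
by apply: eq_Rintegral => x _; rewrite hornerD mulrDl.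
Qed.

Lemma gauss_fctlZ c a q : c != 0 -> gauss_fctl c (a *: q) = a * gauss_fctl c q.
Proof.
move=> c0; rewrite /gauss_fctl -RintegralZl//; last exact: integrable_gauss_fctl.
by apply: eq_Rintegral => x _; rewrite hornerZ mulrA.
Qed.

Lemma gauss_fctl1 c : gauss_fctl c 1 = 1.
Proof.
rewrite /gauss_fctl; under eq_Rintegral do rewrite hornerC mul1r.
by rewrite /Rintegral integral_normal_pdf.
Qed.

Lemma is_derive_horner_scale c q (x : R) :
  is_derive x 1 (fun y => q.[c * y]) (c * q^`().[c * x]).
Proof.
have dq : is_derive (c * x) 1 (horner q) (q^`().[c * x]).
  by split; [exact: derivable_horner|rewrite derivE derive1E].
have dc : is_derive x 1 (fun y => c * y) c.
  by apply: is_derive_eq; rewrite /GRing.scale /= mulr1.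
by rewrite mulrC; exact: (is_derive1_comp dq dc).
Qed.

Lemma gauss_fctlX c q : c != 0 -> gauss_fctl c ('X * q) = gauss_fctl c q^`().
Proof.
move=> c0; apply/eqP; rewrite -subr_eq0; apply/eqP.
have -> : gauss_fctl c ('X * q) - gauss_fctl c q^`() =
          gauss_fctl c ('X * q - q^`()).
  by rewrite gauss_fctlD// -[- q^`()]scaleN1r gauss_fctlZ// mulN1r.
(* The primitive of (X q - q')(c x) times the density. *)
pose F x := - c^-1 * (q.[c * x] * normal_pdf 0 c^-1 x).
have [K K0 qK] := horner_le_expR ('X * q).
rewrite /gauss_fctl.
apply: (@Rintegral_derive_eq0 _ F
  (fun x => ('X * q - q^`()).[c * x] * normal_pdf 0 c^-1 x)
  (c^-1 ^+ 2 * (K * normal_peak c^-1))).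
- move=> x; pose e (y : R) := expR (- ((c * y) ^+ 2 / 2)).
  have -> : F = (fun y => - c^-1 * normal_peak c^-1 * (q.[c * y] * e y)).
    by apply/funext => y; rewrite /F normal_pdf_scaled// /e; ring.
  have dq := is_derive_horner_scale c q x.
  have de : is_derive x 1 e (expR (- ((c * x) ^+ 2 / 2)) * - (c ^+ 2 * x)).
    apply: (@is_derive1_comp _ expR (fun y => - ((c * y) ^+ 2 / 2))).
    by apply: is_derive_eq; rewrite /GRing.scale /=; field.
  apply: is_derive_eq; rewrite /GRing.scale /= normal_pdf_scaled//.
  by rewrite hornerD hornerN hornerM hornerX /e; field.
- move=> x; apply: cvgM; last by apply: continuous_normal_pdf; rewrite invr_eq0.
  apply: (@continuous_comp _ _ _ ( *%R c) (horner _)).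
    2: exact: continuous_horner.
  by apply: cvgM; [exact: cvg_cst|exact: cvg_id].
- exact: integrable_gauss_fctl.
- move=> x.
  have -> : x * F x = - c^-1 ^+ 2 * (('X * q).[c * x] * normal_pdf 0 c^-1 x).
    by rewrite /F hornerM hornerX; field.
  rewrite normrM normrN (ger0_norm (sqr_ge0 _)).
  apply: ler_wpM2l; first exact: sqr_ge0.
  rewrite normrM (ger0_norm (normal_pdf_ge0 _ _ _)) normal_pdf_scaled//.
  apply: (le_trans (ler_wpM2r _ (qK _))).
    by rewrite mulr_ge0 ?normal_peak_ge0 ?expR_ge0.
  rewrite -mulrA; apply: ler_wpM2l => //.
  rewrite mulrCA ler_piMr ?normal_peak_ge0//.
  rewrite -expRD -[leRHS]expR0 ler_expR; have := sqr_ge0 (c * x); lra.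
Qed.

Lemma gauss_fctl_gaussian c : c != 0 -> gaussian_moments (gauss_fctl c).
Proof.
move=> c0; split; [move=> p q; exact: gauss_fctlD|move=> a p; exact: gauss_fctlZ|
  exact: gauss_fctl1|move=> p; exact: gauss_fctlX].
Qed.

End gaussian_functional.

(** * Hermite polynomials and the equation of the kernel *)

(** The definition by the creation operator makes the first use of Gaussian
    integration by parts immediate; the three-term recurrence follows.
    It is locked because its unfolding exhibits a difference and a derivative, to
    which the rules of differentiation would apply. *)
HB.lock Definition hermite {R : realType} (n : nat) : {poly R} :=
  iter n (fun p => 'X * p - p^`()) 1.

Section hermite.
Context {R : realType}.
Implicit Types (p q : {poly R}).

Lemma hermite_rec n :
  hermite n.+1 = 'X * hermite n - (hermite n)^`() :> {poly R}.
Proof. by rewrite unlock. Qed.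

Lemma hermite0 : hermite 0 = 1 :> {poly R}.
Proof. by rewrite unlock. Qed.

Lemma hermite1 : hermite 1 = 'X :> {poly R}.
Proof. by rewrite hermite_rec hermite0 derivC subr0 mulr1. Qed.

Lemma deriv_hermite n : (hermite n)^`() = n%:R *: hermite n.-1 :> {poly R}.
Proof.
elim: n => [|n IH]; first by rewrite hermite0 derivC scale0r.
rewrite hermite_rec derivB derivM derivX mul1r /=.
case: n IH => [|m] IH; first by rewrite hermite0 !derivC mulr0 subr0 addr0 scale1r.
rewrite IH derivZ -scalerAr -addrA -scalerBr -hermite_rec.
by rewrite -[m.+2%:R]natr1 scalerDl scale1r addrC.
Qed.

Lemma hermiteS n :
  hermite n.+1 = 'X * hermite n - n%:R *: hermite n.-1 :> {poly R}.
Proof. by rewrite hermite_rec deriv_hermite. Qed.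

Lemma hermiteSS n :
  hermite n.+2 = 'X * hermite n.+1 - n.+1%:R *: hermite n :> {poly R}.
Proof. exact: hermiteS. Qed.

(** Differentiation conjugated by the Gaussian weight phi:
    (p phi)' = (gderiv p) phi. *)
Definition gderiv p := p^`() - 'X * p.

Lemma gderivD p q : gderiv (p + q) = gderiv p + gderiv q.
Proof. by rewrite /gderiv derivD; ring. Qed.

Lemma gderivZ a p : gderiv (a *: p) = a *: gderiv p.
Proof. by rewrite /gderiv derivZ -scalerAr scalerBr. Qed.

Lemma gderivM p q : gderiv (p * q) = p^`() * q + p * gderiv q.
Proof. by rewrite /gderiv derivM; ring. Qed.

(** The kernel on the diagonal, stripped of its Gaussian weight. *)
Definition kernel_poly n : {poly R} :=
  \sum_(j < n) (j`!%:R)^-1 *: hermite j ^+ 2.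

Lemma kernel_polyS n :
  kernel_poly n.+1 = kernel_poly n + (n`!%:R)^-1 *: hermite n ^+ 2.
Proof. by rewrite /kernel_poly big_ord_recr. Qed.

Let factS n : (n.+1`!%:R : R) = n.+1%:R * n`!%:R.
Proof. by rewrite factS natrM. Qed.

Let fact_neq0 n : (n`!%:R : R) != 0.
Proof. by rewrite pnatr_eq0 -lt0n fact_gt0. Qed.

(** The confluent Christoffel-Darboux formula, in which derivatives have been
    eliminated by the recurrence. *)
Lemma christoffel_darboux n : n`!%:R *: kernel_poly n.+1 =
  n.+1%:R *: hermite n ^+ 2 - 'X * hermite n.+1 * hermite n + hermite n.+1 ^+ 2.
Proof.
elim: n => [|n IH].
  rewrite kernel_polyS /kernel_poly big_ord0 add0r invr1 !scale1r.
  by rewrite hermite1 hermite0; ring.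
rewrite kernel_polyS scalerDr scalerA divff// scale1r factS -scalerA IH.
rewrite hermiteSS -!mul_polyC -[in n.+2%:R]natr1; ring.
Qed.

(** The derivative of the weighted sum telescopes:
    D (He_n^2) = He_n (n He_(n-1) - He_(n+1)). *)
Lemma gderiv_kernel n :
  n`!%:R *: gderiv (kernel_poly n.+1) = - hermite n.+1 * hermite n.
Proof.
elim: n => [|n IH].
  rewrite kernel_polyS /kernel_poly big_ord0 add0r invr1 !scale1r hermite1 hermite0.
  by rewrite /gderiv expr1n derivC; ring.
rewrite kernel_polyS gderivD scalerDr gderivZ scalerA divff// scale1r.
rewrite factS -scalerA IH /gderiv expr2 derivM deriv_hermite /= hermiteSS.
by rewrite -!mul_polyC; ring.
Qed.

(** Applying D to the product He_(n+1) He_n twice more stays within the quadratic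
    forms in these two polynomials, where the kernel itself lives by
    Christoffel-Darboux; the four forms are linearly dependent. *)
Lemma kernel_ode n :
  gderiv (gderiv (gderiv (kernel_poly n.+1))) +
  ((4 * n.+1%:R)%:P - 'X ^+ 2) * gderiv (kernel_poly n.+1) +
  'X * kernel_poly n.+1 = 0.
Proof.
have := gderiv_kernel n; have := christoffel_darboux n.
have : n`!%:R *: gderiv (gderiv (gderiv (kernel_poly n.+1))) =
    gderiv (gderiv (- hermite n.+1 * hermite n)).
  by rewrite -gderiv_kernel !gderivZ.
move: (gderiv (gderiv (gderiv _))) => d3; move: (gderiv (kernel_poly _)) => d1.
move: (kernel_poly _) => d0 e3 e0 e1.
apply: (scalerI (fact_neq0 n)); rewrite scaler0 !scalerDr !scalerAr e3 e0 e1.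
have dh : (hermite n)^`() = 'X * hermite n - hermite n.+1 :> {poly R}.
  by rewrite deriv_hermite hermiteS; ring.
have dh1 : (hermite n.+1)^`() = n.+1%:R%:P * hermite n :> {poly R}.
  by rewrite deriv_hermite mul_polyC.
move: (hermite n.+1) (hermite n) dh dh1 => a b dh dh1.
rewrite /gderiv -!mul_polyC.
rewrite !(derivN, derivB, derivM, derivD, derivX, derivC, dh, dh1).
by rewrite polyCM (rmorph_nat (@polyC R) 4); ring.
Qed.

Section functional.
Variable L : {poly R} -> R.
Hypothesis LG : gaussian_moments L.

Let LD p q : L (p + q) = L p + L q. Proof. by case: LG. Qed.
Let LZ a p : L (a *: p) = a * L p. Proof. by case: LG. Qed.
Let L1 : L 1 = 1. Proof. by case: LG. Qed.
Let LX p : L ('X * p) = L p^`(). Proof. by case: LG. Qed.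
Let LN p : L (- p) = - L p. Proof. by rewrite -scaleN1r LZ mulN1r. Qed.
Let LB p q : L (p - q) = L p - L q. Proof. by rewrite LD LN. Qed.

Lemma hermite_norm n : L (hermite n ^+ 2) = n`!%:R.
Proof.
elim: n => [|n IH]; first by rewrite hermite0 expr1n L1.
rewrite expr2 {1}hermite_rec mulrBl LB -mulrA LX derivM LD addrC addKr.
by rewrite deriv_hermite -scalerAr LZ /= -expr2 IH factS.
Qed.

Lemma kernel_mass n : L (kernel_poly n) = n%:R.
Proof.
elim: n => [|n IH].
  by rewrite /kernel_poly big_ord0 -(scale0r 0) LZ mul0r.
by rewrite kernel_polyS LD IH LZ hermite_norm mulVf// natr1.
Qed.

Lemma gauss_parts p q : L (p * gderiv q) = - L (p^`() * q).
Proof.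
apply/eqP; rewrite -subr_eq0 opprK addrC -LD -gderivM /gderiv LB LX subrr.
exact: eqxx.
Qed.

(** The weak form of [kernel_ode]: all derivatives are moved to the test
    polynomial, and D^3 changes sign under three integrations by parts. *)
Lemma loop_equation n p :
  L ((p^`()^`()^`() + ((4 * n.+1%:R)%:P - 'X ^+ 2) * p^`() - 3%:R *: ('X * p))
     * kernel_poly n.+1) = 0.
Proof.
set S := kernel_poly _.
transitivity (- L (p * (gderiv (gderiv (gderiv S)) +
  ((4 * n.+1%:R)%:P - 'X ^+ 2) * gderiv S + 'X * S))); last first.
  by rewrite kernel_ode mulr0 -(scale0r 0) LZ mul0r oppr0.
set B := _%:P - 'X ^+ 2.
have E a b c : p * (a + B * b + 'X * c) = p * a + p * B * b + p * 'X * c by ring.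
rewrite E LD LD !gauss_parts.
have -> : (p^`()^`()^`() + B * p^`() - 3%:R *: ('X * p)) * S =
          p^`()^`()^`() * S + (p * B)^`() * S - p * 'X * S.
  rewrite -mul_polyC !(derivM, derivB, derivC, derivX, derivXn) /=.
  by rewrite (rmorph_nat (@polyC R) 3); ring.
by rewrite LB LD; ring.
Qed.

Lemma kernel_moment1 n : L ('X * kernel_poly n.+1) = 0.
Proof.
have := loop_equation n 1; rewrite !derivC mulr0 addr0 add0r mulr1 -scaleNr.
rewrite -scalerAl LZ => /eqP; rewrite mulf_eq0 oppr_eq0 pnatr_eq0 /=.
by move=> /eqP.
Qed.

(** The truncated [k.-1] and [k.-2] are harmless: for k < 2 the last term has the
    factor 0. *)
Lemma kernel_moment_rec (n k : nat) :
  k.+4%:R * L ('X^(k.+2) * kernel_poly n.+1) =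
  4 * n.+1%:R * k.+1%:R * L ('X ^+ k * kernel_poly n.+1) +
  (k.+1 * k * k.-1)%:R * L ('X^(k.-2) * kernel_poly n.+1).
Proof.
have dX m : 'X^m^`() = m%:R *: 'X^(m.-1) :> {poly R}.
  by rewrite derivXn scaler_nat.
have := loop_equation n 'X^(k.+1).
have -> : 'X^(k.+1)^`()^`()^`() = (k.+1 * k * k.-1)%:R *: 'X^(k.-2) :> {poly R}.
  rewrite dX derivZ dX !derivZ dX.
  by rewrite 2!scalerA 2!natrM.
rewrite dX [k.+1.-1]/=.
have -> : ((k.+1 * k * k.-1)%:R *: 'X^(k.-2) +
      ((4 * n.+1%:R)%:P - 'X^2) * (k.+1%:R *: 'X^k) -
      3 *: ('X * 'X^(k.+1))) * kernel_poly n.+1 =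
    (k.+1 * k * k.-1)%:R *: ('X^(k.-2) * kernel_poly n.+1) +
    (4 * n.+1%:R * k.+1%:R) *: ('X^k * kernel_poly n.+1) -
    k.+4%:R *: ('X^(k.+2) * kernel_poly n.+1).
  have -> : k.+4%:R = k.+1%:R + 3 :> R by rewrite -natrD addn3.
  move: (_ * _ * _)%:R => u; move: (4 * _) => v; move: (k.+1%:R) => w.
  rewrite [ 'X^(k.+2)]exprS [ 'X^(k.+1)]exprS -!mul_polyC !(polyCD, polyCM).
  move: 'X^k 'X^(k.-2) (kernel_poly _) => X1 X2 S; ring.
by rewrite LB LD !LZ => /eqP; rewrite subr_eq0 addrC eq_sym => /eqP.
Qed.

End functional.
End hermite.

(** * Hermite polynomials as Gaussian expectations *)

Section hermite_expectation.
Context {R : realType}.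

(** The real and imaginary parts of (x + iz)^n as polynomials in z. *)
Fixpoint re_im_pow (x : R) (n : nat) : {poly R} * {poly R} :=
  if n is m.+1 then
    let: (a, b) := re_im_pow x m in (x *: a - 'X * b, x *: b + 'X * a)
  else (1, 0).

Lemma re_im_powS (x : R) n : re_im_pow x n.+1 =
  (x *: (re_im_pow x n).1 - 'X * (re_im_pow x n).2,
   x *: (re_im_pow x n).2 + 'X * (re_im_pow x n).1).
Proof. by rewrite /=; case: (re_im_pow x n). Qed.

Lemma re_im_powE (x z : R) n : (x%:C + 'i * z%:C)%C ^+ n =
  Complex (re_im_pow x n).1.[z] (re_im_pow x n).2.[z].
Proof.
elim: n => [|n IH] /=; first by rewrite expr0 hornerC horner0.
rewrite exprS IH; case: (re_im_pow x n) => a b /=; rewrite !hornerE /=.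
by simpc; congr Complex; ring.
Qed.

Lemma deriv_re_im_pow (x : R) n :
  (re_im_pow x n.+1).1^`() = - (n.+1%:R *: (re_im_pow x n).2) /\
  (re_im_pow x n.+1).2^`() = n.+1%:R *: (re_im_pow x n).1.
Proof.
elim: n => [|n [IH1 IH2]].
  rewrite !re_im_powS /=.
  rewrite !(derivB, derivD, derivN, derivM, derivZ, derivX, derivC).
  by split; rewrite -!mul_polyC; ring.
rewrite !re_im_powS in IH1 IH2 *; move: IH1 IH2.
case: (re_im_pow x n) => a b /= IH1 IH2.
rewrite [(_ *: (_ - _) - _)^`()]derivB [(_ + _)^`()]derivD !derivM !derivZ.
rewrite IH1 IH2 derivX.
by rewrite -!mul_polyC -[n.+2%:R]natr1 polyCD; split; ring.
Qed.

(** Integration by parts in E[Re (x + iZ)^(n+2)] =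
    x E[Re (x + iZ)^(n+1)] - E[Z Im (x + iZ)^(n+1)] produces the three-term
    recurrence. *)
Lemma He_hermite n (x : R) : He n x = (hermite n).[x].
Proof.
pose L := @gauss_fctl R 1.
have n0 : (1 : R) != 0 by exact: oner_neq0.
have HeL m : He m x = L (re_im_pow x m).1.
  rewrite /He /HeC /cexpectation /= unlock.
  transitivity (\int[normal_prob (0 : R) 1]_z (re_im_pow x m).1.[z]).
    by congr fine; apply: eq_integral => z _; rewrite re_im_powE.
  have dN : has_density (normal_prob (0 : R) 1) (normal_pdf 0 1).
    by split=> //; [exact: measurable_normal_pdf|exact: normal_pdf_ge0].
  rewrite (Rintegral_density dN); last first.
    exact: (continuous_measurable_fun (@continuous_horner _ _)).
  by rewrite /L /gauss_fctl invr1; apply: eq_Rintegral => z _; rewrite mul1r.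
have LS m : L (re_im_pow x m.+2).1 =
    x * L (re_im_pow x m.+1).1 - m.+1%:R * L (re_im_pow x m).1.
  rewrite re_im_powS /= -scaleN1r [L _]gauss_fctlD// !gauss_fctlZ// mulN1r.
  by rewrite gauss_fctlX// (deriv_re_im_pow x m).2 gauss_fctlZ.
suff: He n x = (hermite n).[x] /\ He n.+1 x = (hermite n.+1).[x] by case.
rewrite !HeL; elim: n => [|n [IH1 IH2]].
  rewrite re_im_powS /= mulr0 subr0 /L gauss_fctlZ// gauss_fctl1.
  by rewrite hermite0 hermite1 hornerC hornerX mulr1.
split=> //; rewrite LS IH1 IH2 hermiteSS.
by rewrite hornerD hornerN hornerM hornerX hornerZ.
Qed.

End hermite_expectation.

(** * The semicircle law *)

Section semicircle.
Context {R : realType}.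
Notation lebesgue := (@lebesgue_measure R).
Implicit Types (q : {poly R}).

Definition half_circle (x : R) : R := Num.sqrt (4 - x ^+ 2).

Local Notation s := half_circle.

Lemma continuous_half_circle : continuous s.
Proof.
move=> x; apply: (@continuous_comp _ _ _ (fun x : R => 4 - x ^+ 2) Num.sqrt).
  by apply: cvgB; [exact: cvg_cst|exact: exprn_continuous].
exact: sqrt_continuous.
Qed.

Lemma semicircle_pdf_ge0 (x : R) : 0 <= semicircle_pdf x.
Proof. by rewrite /semicircle_pdf !mulr_ge0// invr_ge0 mulr_ge0// pi_ge0. Qed.

Lemma measurable_semicircle_pdf : measurable_fun [set: R] (@semicircle_pdf R).
Proof.
apply: measurable_funM; last exact: measurable_indic.
apply: measurable_funM => //.
exact: (continuous_measurable_fun continuous_half_circle).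
Qed.

Lemma Rintegral_semicircle (f : R -> R) :
  continuous f ->
  \int[lebesgue]_x (f x * semicircle_pdf x) =
  (2 * pi)^-1 * \int[lebesgue]_(x in `[-2, 2]) (f x * s x).
Proof.
move=> cf.
rewrite -RintegralZl//; last first.
  apply: continuous_compact_integrable; first exact: segment_compact.
  apply: continuous_subspaceT => x.
  by apply: cvgM; [exact: cf|exact: continuous_half_circle].
rewrite [RHS]Rintegral_mkcond; apply: eq_Rintegral => x _.
rewrite /semicircle_pdf patchE indicE.
by case: ifP => _; rewrite ?mulr1 ?mulr0// mulrCA.
Qed.

Lemma integrable_semicircle (f : R -> R) : continuous f ->
  lebesgue.-integrable [set: R] (fun x => (f x * semicircle_pdf x)%:E).
Proof.
move=> cf.
have -> : (fun x => (f x * semicircle_pdf x)%:E) =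
   (EFin \o (fun x => f x * ((2 * pi)^-1 * s x))) \_ `[-2, 2].
  apply/funext => x; rewrite /semicircle_pdf patchE indicE /=.
  by case: ifP => _; rewrite ?mulr1 ?mulr0.
rewrite -integrable_mkcond//.
apply: continuous_compact_integrable; first exact: segment_compact.
apply: continuous_subspaceT => x; apply: cvgM; first exact: cf.
apply: cvgM; [exact: cvg_cst|exact: continuous_half_circle].
Qed.

(** The substitution x = 2 sin t avoids a primitive that is singular at the end
    points. *)
Lemma integral_half_circle :
  (\int[lebesgue]_(x in `[(-2)%R, 2%R]) (s x)%:E = (2 * pi)%:E)%E.
Proof.
pose F (t : R) := 2 * sin t.
pose a : R := pi / 2.
have a0 : 0 < a by rewrite divr_gt0// pi_gt0.
have Fa : F a = 2 by rewrite /F sin_pihalf mulr1.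
have FNa : F (- a) = -2 by rewrite /F sinN sin_pihalf mulrN1.
have dF (t : R) : is_derive t 1 F (2 * cos t).
  by apply: is_derive_eq.
have F' : F^`()%classic = (fun t => 2 * cos t).
  by apply/funext => t; rewrite derive1E; have [_ ->] := dF t.
have cF t : {for t, continuous F}.
  by apply: differentiable_continuous; apply/derivable1_diffP; case: (dF t).
have cF' : continuous (fun t : R => 2 * cos t).
  by move=> t; apply: cvgM; [exact: cvg_cst|exact: continuous_cos].
rewrite -FNa -Fa integration_by_substitution_increasing.
- rewrite F'.
  pose G (t : R) := 2 * t + 2 * (sin t * cos t).
  have dG (t : R) : is_derive t 1 G (2 + 2 * (cos t * cos t - sin t * sin t)).
    apply: is_derive_eq; rewrite /GRing.scale /=; ring.
  rewrite (@continuous_FTC2 _ _ G) ?gtrN//.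
  + rewrite Fa /G /a sinN cosN cos_pihalf -EFinB !mulr0 !addr0; congr EFin; lra.
  + apply: continuous_subspaceT => t; apply: cvgM; last exact: cF'.
    apply: (@continuous_comp _ _ _ F s); first exact: cF.
    exact: continuous_half_circle.
  + have cG t : {for t, continuous G}.
      by apply: differentiable_continuous; apply/derivable1_diffP; case: (dG t).
    split; [by move=> t _; case: (dG t)| |];
      [exact/cvg_at_right_filter/cG|exact/cvg_at_left_filter/cG].
  + move=> t; rewrite in_itv/= => /andP[ta tb].
    rewrite derive1E; have [_ ->] := dG t.
    have ct : 0 <= cos t by apply: cos_ge0_pihalf; rewrite !ltW.
    rewrite [RHS](_ : _ = Num.sqrt (4 - (2 * sin t) ^+ 2) * (2 * cos t))//.
    have -> : 4 - (2 * sin t) ^+ 2 = (2 * cos t) ^+ 2.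
      by rewrite !exprMn cos2sin2; ring.
    rewrite sqrtr_sqr ger0_norm; last by rewrite mulr_ge0.
    by have := cos2sin2 t; rewrite !expr2; lra.
- by rewrite ltW// gtrN.
- move=> x y xa ya xy; rewrite /F ltr_pM2l// ltr_sin//.
- by rewrite F' => t _; exact: cF'.
- rewrite F'; apply/cvg_ex; exists (2 * cos (- a)).
  exact/cvg_at_right_filter/cF'.
- rewrite F'; apply/cvg_ex; exists (2 * cos a).
  exact/cvg_at_left_filter/cF'.
- split; [by move=> t _; case: (dF t)| |];
      [exact/cvg_at_right_filter/cF|exact/cvg_at_left_filter/cF].
- by apply: continuous_subspaceT; exact: continuous_half_circle.
Qed.

Lemma integral_semicircle_pdf : (\int[lebesgue]_x (semicircle_pdf x)%:E = 1)%E.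
Proof.
have i1 : lebesgue.-integrable [set: R] (fun x => (semicircle_pdf x)%:E).
  have -> : (fun x => (semicircle_pdf x)%:E) =
      (fun x : R => (cst 1 x * semicircle_pdf x)%:E).
    by apply/funext => x /=; rewrite mul1r.
  by apply: integrable_semicircle => x; exact: cvg_cst.
rewrite -[LHS]fineK; last exact: integrable_fin_num.
congr EFin; transitivity (\int[lebesgue]_x (cst 1 x * @semicircle_pdf R x)).
  by apply: eq_Rintegral => x _ /=; rewrite mul1r.
rewrite Rintegral_semicircle; last by move=> x; exact: cvg_cst.
rewrite /Rintegral; under eq_integral do rewrite /= mul1r.
by rewrite integral_half_circle/= mulVf// gt_eqF// mulr_gt0// pi_gt0.
Qed.

(** The weak form of (4 - x^2) s' + x s = 0: the integrand is the derivative of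
    (4 - x^2) q s, which vanishes at both end points. *)
Lemma semicircle_parts q :
  \int[lebesgue]_x (((4%:P - 'X ^+ 2) * q^`() - 3%:R *: ('X * q)).[x] *
    semicircle_pdf x) = 0.
Proof.
rewrite Rintegral_semicircle; last exact: continuous_horner.
pose F x := ((4%:P - 'X ^+ 2) * q).[x] * s x.
have cF x : {for x, continuous F}.
  by apply: cvgM; [exact: continuous_horner|exact: continuous_half_circle].
have dF (x : R) : x \in `]-2, 2[ -> is_derive x 1 F
   (((4%:P - 'X ^+ 2) * q^`() - 3%:R *: ('X * q)).[x] * s x).
  rewrite in_itv/= => /andP[x1 x2].
  have x4 : 0 < 4 - x ^+ 2 by nra.
  have s0 : s x != 0 by rewrite gt_eqF// sqrtr_gt0.
  have sx : 4 - x ^+ 2 = s x ^+ 2 by rewrite sqr_sqrtr// ltW.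
  have dq : is_derive x 1 (horner ((4%:P - 'X ^+ 2) * q))
      (((4%:P - 'X ^+ 2) * q)^`().[x]).
    by split; [exact: derivable_horner|rewrite derivE derive1E].
  have ds : is_derive x 1 s ((2 * s x)^-1 * - (2 * x)).
    apply: (@is_derive1_comp _ Num.sqrt (fun y => 4 - y ^+ 2)).
      exact: is_derive1_sqrt.
    by apply: is_derive_eq; rewrite /GRing.scale /=; ring.
  apply: is_derive_eq; rewrite /GRing.scale /=.
  rewrite !(derivM, derivB, derivC, derivX, derivXn) !hornerE /=.
  by rewrite sx; field.
have ftc : (\int[lebesgue]_(x in `[(-2)%R, 2%R])
    (((4%:P - 'X ^+ 2) * q^`() - 3%:R *: ('X * q)).[x] * s x)%:E =
    (F 2)%:E - (F (-2))%:E)%E.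
  apply: continuous_FTC2.
  - by rewrite gtrN.
  - apply: continuous_subspaceT => y.
    by apply: cvgM; [exact: continuous_horner|exact: continuous_half_circle].
  - split; [by move=> y /dF[]| |];
      [exact/cvg_at_right_filter/cF|exact/cvg_at_left_filter/cF].
  - by move=> y /dF h; rewrite derive1E; have [_ ->] := h.
have s2 : s 2 = 0.
  by rewrite /half_circle (_ : 4 - 2 ^+ 2 = 0) ?sqrtr0//; ring.
have sN2 : s (-2) = 0.
  by rewrite /half_circle (_ : 4 - (-2) ^+ 2 = 0) ?sqrtr0//; ring.
by rewrite /Rintegral ftc /F s2 sN2 !mulr0 subee//= mulr0.
Qed.

End semicircle.

(** * Moments of the semicircle law and their stability *)

Section semicircle_moments.
Context {R : realType}.

Lemma cvg_moment_rec (m : nat -> nat -> R) (s : nat -> R) :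
  (forall n, m n 0 = s 0) -> (forall n, m n 1 = s 1) ->
  (forall k, k.+4%:R * s k.+2 = 4 * k.+1%:R * s k) ->
  (forall n k, k.+4%:R * m n k.+2 = 4 * k.+1%:R * m n k +
     (k.+1 * k * k.-1)%:R * n.+1%:R^-1 ^+ 2 * m n k.-2) ->
  forall k, m n k @[n --> \oo] --> s k.
Proof.
move=> m0 m1 srec mrec; elim/ltn_ind => -[|[|k]] IH.
- by under eq_fun do rewrite m0; exact: cvg_cst.
- by under eq_fun do rewrite m1; exact: cvg_cst.
have k4 : k.+4%:R != 0 :> R by rewrite pnatr_eq0.
have -> : s k.+2 = k.+4%:R^-1 * (4 * k.+1%:R * s k +
    (k.+1 * k * k.-1)%:R * 0 ^+ 2 * s k.-2).
  by rewrite expr0n /= mulr0 mul0r addr0 -srec mulKf.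
have -> : (fun n => m n k.+2) = (fun n => k.+4%:R^-1 * (4 * k.+1%:R * m n k +
    (k.+1 * k * k.-1)%:R * n.+1%:R^-1 ^+ 2 * m n k.-2)).
  by apply/funext => n; rewrite -mrec mulKf.
apply: cvgM; first exact: cvg_cst.
apply: cvgD; first by apply: cvgM; [exact: cvg_cst|exact: IH].
apply: cvgM.
  apply: cvgM; first exact: cvg_cst.
  by rewrite !expr2; apply: cvgM; exact: cvg_harmonic.
by apply: IH; rewrite ltnS; case: k {k4} => [|[|k]] //; rewrite !leqW.
Qed.

Definition semicircle_moment (k : nat) : R :=
  \int[lebesgue_measure]_x (x ^+ k * semicircle_pdf x).

Let si (q : {poly R}) : (@lebesgue_measure R).-integrable [set: R]
  (EFin \o (fun x => q.[x] * semicircle_pdf x)).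
Proof. by apply: integrable_semicircle; exact: continuous_horner. Qed.

Lemma semicircle_moment0 : semicircle_moment 0 = 1.
Proof.
rewrite /semicircle_moment; under eq_Rintegral do rewrite expr0 mul1r.
by rewrite /Rintegral integral_semicircle_pdf.
Qed.

Lemma semicircle_moment1 : semicircle_moment 1 = 0.
Proof.
have := semicircle_parts (1 : {poly R}).
have -> : (4%:P - 'X ^+ 2) * (1 : {poly R})^`() - 3%:R *: ('X * 1) = - 3%:R *: 'X.
  by rewrite derivC mulr0 sub0r mulr1 scaleNr.
under eq_Rintegral do rewrite hornerZ hornerX -mulrA.
rewrite RintegralZl//; last by have := si 'X; under eq_fun do rewrite /= hornerX.
by move=> /eqP; rewrite mulf_eq0 oppr_eq0 pnatr_eq0 /= => /eqP.
Qed.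

Lemma semicircle_moment_rec k :
  k.+4%:R * semicircle_moment k.+2 = 4 * k.+1%:R * semicircle_moment k.
Proof.
have := semicircle_parts ('X^(k.+1) : {poly R}).
have -> : (4%:P - 'X ^+ 2) * ('X^(k.+1) : {poly R})^`() -
      3%:R *: ('X * 'X^(k.+1)) =
    (4 * k.+1%:R) *: 'X^k - k.+4%:R *: 'X^(k.+2).
  have -> : ('X^(k.+1) : {poly R})^`() = k.+1%:R *: 'X^k.
    by rewrite derivXn scaler_nat.
  have -> : k.+4%:R = k.+1%:R + 3 :> R by rewrite -natrD addn3.
  move: (k.+1%:R) => w.
  rewrite [ 'X^(k.+2)]exprS [ 'X^(k.+1)]exprS -!mul_polyC !(polyCD, polyCM).
  move: 'X^k => X1; ring.
have -> : \int[lebesgue_measure]_x (((4 * k.+1%:R) *: 'X^k -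
      k.+4%:R *: 'X^(k.+2)).[x] * @semicircle_pdf R x) =
   4 * k.+1%:R * semicircle_moment k - k.+4%:R * semicircle_moment k.+2.
  have ik (a : R) j : (@lebesgue_measure R).-integrable [set: R]
      (EFin \o (fun x => a * (x ^+ j * semicircle_pdf x))).
    have := si (a *: 'X^j); congr (integrable _ _ _); apply/funext => x /=.
    by rewrite hornerZ hornerXn mulrA.
  have ik1 j : (@lebesgue_measure R).-integrable [set: R]
      (EFin \o (fun x => x ^+ j * semicircle_pdf x)).
    have := si 'X^j; congr (integrable _ _ _); apply/funext => x /=.
    by rewrite hornerXn.
  rewrite /semicircle_moment -!RintegralZl// -RintegralB//.
  apply: eq_Rintegral => x _.
  by rewrite hornerD hornerN !hornerZ !hornerXn; ring.
by move=> /eqP; rewrite subr_eq0 => /eqP.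
Qed.

Lemma semicircle_moment_ge0 k : 0 <= semicircle_moment (2 * k).
Proof.
apply: Rintegral_ge0 => x _; apply: mulr_ge0; last exact: semicircle_pdf_ge0.
by rewrite exprM exprn_ge0// sqr_ge0.
Qed.

(** The recursion multiplies the even moments by 4 (2k+1) / (2k+4) <= 4 at each
    step. *)
Lemma semicircle_moment_le k : semicircle_moment (2 * k) <= 2 ^+ (2 * k).
Proof.
elim: k => [|k IH]; first by rewrite muln0 semicircle_moment0 expr0.
have rec := semicircle_moment_rec (2 * k).
have k40 : 0 < (2 * k).+4%:R :> R by rewrite ltr0n.
have e2 : 2 ^+ (2 + 2 * k) = 4 * 2 ^+ (2 * k) :> R.
  by rewrite exprD; congr (_ * _); ring.
rewrite mulnS e2 -(ler_pM2l k40) rec -[(2 * k).+4]addn3 natrD.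
have m0 := semicircle_moment_ge0 k.
have : 0 <= (2 * k).+1%:R :> R by [].
move: ((2 * k).+1%:R) (semicircle_moment _) (2 ^+ (2 * k)) IH m0.
move=> w m t IH m0 w0.
by nra.
Qed.

End semicircle_moments.

(** * The rescaled Hermite densities *)

Section hermite_density.
Context {R : realType}.

Lemma hermite_kernel_diag n (y : R) : hermite_kernel n y y =
  (Num.sqrt (2 * pi))^-1 * (kernel_poly n).[y] * expR (- (y ^+ 2 / 2)).
Proof.
rewrite /hermite_kernel /kernel_poly horner_sum mulr_sumr mulr_suml.
apply: eq_bigr => j _; rewrite hornerZ horner_exp -He_hermite /Psi.
have p0 : 0 < 2 * pi :> R by rewrite mulr_gt0// pi_gt0.
set e := expR _; set w := Num.sqrt (_ * e).
have we : w * w = (Num.sqrt (2 * pi))^-1 * e.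
  by rewrite -expr2 sqr_sqrtr// mulr_ge0 ?expR_ge0// invr_ge0 sqrtr_ge0.
have je : (Num.sqrt j`!%:R)^-1 * (Num.sqrt j`!%:R)^-1 = (j`!%:R)^-1 :> R.
  by rewrite -invfM -expr2 sqr_sqrtr.
have E a H : a * H * w * (a * H * w) = (a * a * H ^+ 2) * (w * w) :> R by ring.
by rewrite E we je; ring.
Qed.

Lemma hermite_densityE n (x : R) : (0 < n)%N ->
  (Num.sqrt n%:R)^-1 * hermite_kernel n (Num.sqrt n%:R * x) (Num.sqrt n%:R * x) =
  n%:R^-1 * (kernel_poly n).[Num.sqrt n%:R * x] *
  normal_pdf 0 (Num.sqrt n%:R)^-1 x.
Proof.
move=> n0; set c := Num.sqrt n%:R.
have c0 : 0 < c by rewrite sqrtr_gt0 ltr0n.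
have cn : n%:R = c ^+ 2 by rewrite sqr_sqrtr.
rewrite hermite_kernel_diag normal_pdf_scaled ?gt_eqF//.
have -> : normal_peak c^-1 = c / Num.sqrt (2 * pi).
  rewrite /normal_peak -mulr_natr.
  have -> : c^-1 ^+ 2 * pi * 2 = c^-1 ^+ 2 * (2 * pi) by ring.
  by rewrite sqrtrM ?sqr_ge0// sqrtr_sqr gtr0_norm ?invr_gt0// invfM invrK.
rewrite cn; field; rewrite !gt_eqF//.
by rewrite sqrtr_gt0 mulr_gt0// pi_gt0.
Qed.

Definition hermite_density (n : nat) (x : R) : R := (Num.sqrt n%:R)^-1 *
  hermite_kernel n (Num.sqrt n%:R * x) (Num.sqrt n%:R * x).

Local Notation c n := (Num.sqrt n.+1%:R : R).

Let c0 n : c n != 0.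
Proof. by rewrite gt_eqF// sqrtr_gt0. Qed.

Lemma monomial_hermite_density n k x : x ^+ k * hermite_density n.+1 x =
  (n.+1%:R^-1 * (c n)^-1 ^+ k) *
  (('X^k * kernel_poly n.+1).[c n * x] * normal_pdf 0 (c n)^-1 x).
Proof.
rewrite /hermite_density hermite_densityE// hornerM hornerXn exprMn.
set d := c n; have ck : d^-1 ^+ k * d ^+ k = 1.
  by rewrite -exprMn (mulVf (c0 n)) expr1n.
rewrite -[LHS]mul1r -{1}ck; move: (d^-1 ^+ k) => b; ring.
Qed.

Lemma integrable_monomial_hermite_density n k :
  (@lebesgue_measure R).-integrable [set: R]
    (fun x => (x ^+ k * hermite_density n.+1 x)%:E).
Proof.
under eq_fun do rewrite monomial_hermite_density EFinM.
by apply: integrableZl => //; exact: integrable_gauss_fctl.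
Qed.

Lemma Rintegral_monomial_hermite_density n k :
  \int[lebesgue_measure]_x (x ^+ k * hermite_density n.+1 x) =
  n.+1%:R^-1 * (c n)^-1 ^+ k * gauss_fctl (c n) ('X^k * kernel_poly n.+1).
Proof.
under eq_Rintegral do rewrite monomial_hermite_density.
by rewrite RintegralZl//; exact: integrable_gauss_fctl.
Qed.

Let kernel_mass_gauss n :
  gauss_fctl (c n) (kernel_poly n.+1) = n.+1%:R.
Proof. by apply: kernel_mass; exact: gauss_fctl_gaussian. Qed.

Lemma hermite_density_ge0 n x : 0 <= hermite_density n.+1 x.
Proof.
rewrite /hermite_density mulr_ge0// ?invr_ge0// /hermite_kernel sumr_ge0// => j _.
by rewrite -expr2 sqr_ge0.
Qed.

Lemma integrable_hermite_density n : (@lebesgue_measure R).-integrable [set: R]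
    (fun x => (hermite_density n.+1 x)%:E).
Proof.
have := integrable_monomial_hermite_density n 0.
by congr (integrable _ _ _); apply/funext => x; rewrite expr0 mul1r.
Qed.

Lemma integral_hermite_density n :
  (\int[lebesgue_measure]_x (hermite_density n.+1 x)%:E = 1)%E.
Proof.
rewrite -[LHS]fineK; last first.
  by apply: integrable_fin_num => //; exact: integrable_hermite_density.
have := Rintegral_monomial_hermite_density n 0.
under eq_Rintegral do rewrite expr0 mul1r.
by rewrite /Rintegral => ->; rewrite expr0 mulr1 mul1r kernel_mass_gauss mulVf.
Qed.

Lemma cvg_hermite_moment k :
  \int[lebesgue_measure]_x (x ^+ k * hermite_density n.+1 x) @[n --> \oo]
    --> @semicircle_moment R k.
Proof.
apply: (@cvg_moment_rec _ (fun n k =>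
  \int[lebesgue_measure]_x (x ^+ k * hermite_density n.+1 x))
  semicircle_moment) => [n|n|j|n j].
- rewrite Rintegral_monomial_hermite_density !expr0 mulr1 mul1r.
  by rewrite kernel_mass_gauss mulVf// semicircle_moment0.
- rewrite Rintegral_monomial_hermite_density semicircle_moment1 expr1.
  by rewrite kernel_moment1 ?mulr0//; exact: gauss_fctl_gaussian.
- exact: semicircle_moment_rec.
rewrite !Rintegral_monomial_hermite_density.
have H := kernel_moment_rec (gauss_fctl_gaussian (c0 n)) n j.
rewrite mulrCA H; set d := c n.
have cn : n.+1%:R = d ^+ 2 by rewrite sqr_sqrtr.
(* For j < 2 both sides are 0, so the truncation in j.-2 does not matter. *)
have cj : (j.+1 * j * j.-1)%:R * (d)^-1 ^+ j.+2 =
    (j.+1 * j * j.-1)%:R * (n.+1%:R^-1 ^+ 2 * (d)^-1 ^+ j.-2).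
  case: j {H} => [|[|j]]; rewrite ?muln0 ?mul0r//.
  by congr (_ * _); rewrite cn -exprVn -exprM -exprD.
rewrite mulrDr; congr (_ + _).
  rewrite [(d)^-1 ^+ j.+2]exprS [(d)^-1 ^+ j.+1]exprS.
  move: (gauss_fctl _ _) ((d)^-1 ^+ j) => M ck.
  by rewrite cn; field; exact: (c0 n).
move: (gauss_fctl _ _) => M.
transitivity (n.+1%:R^-1 * ((j.+1 * j * j.-1)%:R * (d)^-1 ^+ j.+2) * M).
  by ring.
by rewrite cj; ring.
Qed.

Lemma measurable_hermite_density n :
  measurable_fun [set: R] (hermite_density n.+1).
Proof.
apply/measurable_EFinP; exact: measurable_int (integrable_hermite_density n).
Qed.

End hermite_density.

(** * Convergence to the semicircle law *)

Theorem corollary4p12 (R : realType) :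
  (forall (n : nat) (x : R), (0 < n)%N ->
     (Num.sqrt n%:R)^-1 *
       hermite_kernel n (Num.sqrt n%:R * x) (Num.sqrt n%:R * x) =
     (Num.sqrt (2 * pi * n%:R))^-1 *
       (\sum_(k < n) He k (Num.sqrt n%:R * x) ^+ 2 / k`!%:R) *
       expR (- (n%:R * x ^+ 2 / 2))) /\
  exists (mu : nat -> probability (measurableTypeR R) R)
         (sc : probability (measurableTypeR R) R),
    [/\ forall n : nat, (0 < n)%N ->
          has_density (mu n) (fun x : R => (Num.sqrt n%:R)^-1 *
            hermite_kernel n (Num.sqrt n%:R * x) (Num.sqrt n%:R * x)),
        has_density sc semicircle_pdf &
        weakly_converges mu sc].
Proof.
split=> [n x n0|].
  have p0 : 0 <= 2 * pi :> R by rewrite mulr_ge0// pi_ge0.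
  rewrite hermite_kernel_diag exprMn sqr_sqrtr// (sqrtrM _ p0).
  rewrite invfM !mulrA [_^-1 / Num.sqrt n%:R]mulrC; congr (_ * _ * _).
  rewrite horner_sum; apply: eq_bigr => k _.
  by rewrite hornerZ horner_exp He_hermite mulrC.
have [M MP] : exists M : nat -> probability (measurableTypeR R) R,
    forall n, has_density (M n) (hermite_density n.+1).
  have ex n : {P : probability (measurableTypeR R) R |
      has_density P (hermite_density n.+1)}.
    apply: cid; apply: exists_density_prob; [exact: measurable_hermite_density|
      exact: hermite_density_ge0|exact: integral_hermite_density].
  by exists (fun n => sval (ex n)) => n; exact: (svalP (ex n)).
have [sc scP] := exists_density_prob (@measurable_semicircle_pdf R)
  (@semicircle_pdf_ge0 R) (@integral_semicircle_pdf R).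
have mX k : measurable_fun [set: R] (fun x : R => x ^+ k).
  by apply: continuous_measurable_fun; exact: exprn_continuous.
have scE k : \int[sc]_x (x ^+ k) = @semicircle_moment R k.
  by rewrite (Rintegral_density scP).
(* The density of index 0 is not a probability density: the family is indexed
   from n = 1 on, and mu 0 is arbitrary. *)
exists (fun n => M n.-1), sc; split => //.
  by move=> [//|n] _; exact: MP.
have wM : weakly_converges M sc.
  apply: (@weakly_converges_moments _ _ _ 2) => //.
  - move=> n k; apply: (integrable_densityP (MP n)) => //.
    exact: integrable_monomial_hermite_density.
  - move=> k; apply: (integrable_densityP scP) => //.
    by apply: integrable_semicircle; exact: exprn_continuous.
  - move=> k; rewrite scE; under eq_fun do rewrite (Rintegral_density (MP _))//.
    exact: cvg_hermite_moment.
  - by move=> k; rewrite scE; exact: semicircle_moment_le.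
move=> f cf bf; rewrite -cvg_shiftS /=; exact: wM.
Qed.
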